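(* Let $q,a,b$ be nonzero complex numbers with $|q|<1$ and $\max\{|ab|,|qa|,|qb|\}<1$, and let $x$ be a complex number which is neither zero nor an integral power of $q$. Then $$\frac{(q,ab;q)_\infty}{(aq,bq;q)_\infty}\;{}_3\phi_2\left(\begin{matrix}q/a,\,q/b,\,q\\ xq,\,q^2/x\end{matrix};q,ab\right)=\sum_{n=0}^\infty(1-q^{2n+1})\frac{(1-x)(1-q/x)}{(1-xq^n)(1-q^{n+1}/x)}\,\frac{(q/a,q/b;q)_n}{(aq,bq;q)_n}(-ab)^nq^{(n^2+n)/2}.$$
   Context: Notation: $(y;q)_0=1$, $(y;q)_n=\prod_{k=0}^{n-1}(1-yq^k)$, $(y;q)_\infty=\prod_{k=0}^\infty(1-yq^k)$, $(y_1,\dots,y_k;q)_n=(y_1;q)_n\cdots(y_k;q)_n$ (also for $n=\infty$), and $${}_3\phi_2\left(\begin{matrix}A_1,A_2,A_3\\ B_1,B_2\end{matrix};q,z\right)=\sum_{n=0}^\infty\frac{(A_1,A_2,A_3;q)_n}{(q,B_1,B_2;q)_n}z^n .$$ *)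

(* Defs.v *)
From Stdlib Require Import Reals ZArith.
From Coquelicot Require Import Coquelicot.

Open Scope C_scope.

(** Integer powers in [C], on the pattern of [powerRZ]. *)
Definition Cpowz (z : C) (m : Z) : C :=
  match m with
  | Z0 => 1
  | Zpos p => z ^ Pos.to_nat p
  | Zneg p => / z ^ Pos.to_nat p
  end.

(** Total limit and sum of complex sequences, in the style of [RInt]: they
    are meaningful only when the limit exists; the predicate [ex_series]
    asserts this for series. *)
Definition Clim_seq (u : nat -> C) : C :=
  @iota (CompleteNormedModule.CompleteSpace _ C_CompleteNormedModule)
    (fun l : C => filterlim u eventually (locally l)).

Definition CSeries (u : nat -> C) : C :=
  @iota (CompleteNormedModule.CompleteSpace _ C_CompleteNormedModule)
    (is_series u).

(** [(y;q)_n] *)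
Fixpoint qpoch (y q : C) (n : nat) : C :=
  match n with
  | O => 1
  | S k => qpoch y q k * (1 - y * q ^ k)
  end.

(** [(y;q)_oo]; the partial products converge whenever [Cmod q < 1]. *)
Definition qpoch_inf (y q : C) : C := Clim_seq (qpoch y q).

Definition phi32_term (A1 A2 A3 B1 B2 q z : C) (n : nat) : C :=
  (qpoch A1 q n * qpoch A2 q n * qpoch A3 q n)
  / (qpoch q q n * qpoch B1 q n * qpoch B2 q n) * z ^ n.

Definition phi32 (A1 A2 A3 B1 B2 q z : C) : C :=
  CSeries (phi32_term A1 A2 A3 B1 B2 q z).

(* Main.v *)
Require Import Defs.
From Stdlib Require Import Reals ZArith Lia Lra.
From Coquelicot Require Import Coquelicot.
Open Scope C_scope.

(** Bailey's lemma relative to [q].  The partial fraction expansion in [x] of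
    [1 / ((x;q)_(n+1) (q/x;q)_(n+1))] is [sum_(r <= n) alpha_r /
    ((q;q)_(n-r) (q;q)_(n+r+1))] for an explicit [alpha_r] of Gaussian decay.
    Inserting it in the 3phi2 series and exchanging the two summations leaves,
    for each [r], an inner 2phi1 series in [n] which the q-Gauss sum evaluates
    as a quotient of infinite products.  The q-Gauss sum itself follows from
    the contiguous relation [z -> z q], iterated to [z q^N -> 0]; both that
    relation and the partial fraction expansion come from explicit telescoping
    certificates. *)

(** * Limits of complex sequences *)

Notation Ctends u l :=
  (@filterlim nat C u eventually (@locally C_UniformSpace (l : C))).

(** The upper bound is excluded, unlike in [sum_n], so that the empty sum is available as the base
    of every induction. *)
Fixpoint csum (f : nat -> C) (n : nat) : C :=
  match n with
  | O => 0
  | S k => csum f k + f k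
  end.

Lemma Ctends_eps (u : nat -> C) (l : C) :
  Ctends u l <->
  forall eps : R, (0 < eps)%R ->
    exists N, forall n, (N <= n)%nat -> (Cmod (u n - l) < eps)%R.
Proof.
  rewrite (filterlim_locally_ball_norm (U := C_NormedModule) u l).
  split.
  - intros H eps He. exact (H (mkposreal eps He)).
  - intros H eps. exact (H (pos eps) (cond_pos eps)).
Qed.

Lemma Ctends_unique (u : nat -> C) (l l' : C) :
  Ctends u l -> Ctends u l' -> l = l'.
Proof.
  exact (filterlim_locally_unique (V := C_NormedModule) u l l').
Qed.

Lemma Ctends_ext (u v : nat -> C) (l : C) :
  (forall n, u n = v n) -> Ctends u l -> Ctends v l.
Proof. intros H. apply filterlim_ext. exact H. Qed.

Lemma Ctends_const (l : C) : Ctends (fun _ => l) l.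
Proof. apply filterlim_const. Qed.

Lemma Ctends_plus (u v : nat -> C) (l l' : C) :
  Ctends u l -> Ctends v l' -> Ctends (fun n => u n + v n) (l + l').
Proof.
  intros Hu Hv.
  exact (filterlim_comp_2 u v Cplus Hu Hv (filterlim_plus (V := C_NormedModule) l l')).
Qed.

Lemma Ctends_shift (u : nat -> C) (l : C) (k : nat) :
  Ctends u l -> Ctends (fun n => u (n + k)%nat) l.
Proof.
  rewrite !Ctends_eps. intros H eps He. destruct (H eps He) as [N HN].
  exists N. intros n Hn. apply HN. lia.
Qed.

Lemma Ctends_mult (u v : nat -> C) (l l' : C) :
  Ctends u l -> Ctends v l' -> Ctends (fun n => u n * v n) (l * l').
Proof.
  (* [filterlim_mult] lives on the uniform structure that [C] gets as an
     absolute ring, which is not convertible to [C_UniformSpace]. *)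
  assert (E : forall (w : nat -> C) (m : C),
    @filterlim nat C w eventually (@locally (AbsRing_UniformSpace C_AbsRing) m)
    <-> Ctends w m).
  { intros w m. rewrite Ctends_eps.
    rewrite (filterlim_locally (U := AbsRing_UniformSpace C_AbsRing)
               (F := eventually) w m).
    split.
    - intros H eps He. exact (H (mkposreal eps He)).
    - intros H eps. exact (H (pos eps) (cond_pos eps)). }
  rewrite <- !E. intros Hu Hv.
  exact (filterlim_comp_2 u v Cmult Hu Hv
           (filterlim_mult (K := C_AbsRing) l l')).
Qed.

Lemma Ctends_dominated (u : nat -> C) (l : C) (K r : R) :
  (0 <= r < 1)%R -> (forall n, (Cmod (u n - l) <= K * r ^ n)%R) -> Ctends u l.
Proof.
  intros Hr H. rewrite Ctends_eps. intros eps He.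
  (* The nested term only turns [r < 1] into [Rabs r < 1]. Since [K] may have any sign, the
     threshold is divided by [Rabs K + 1], which is positive. *)
  destruct (pow_lt_1_zero r (proj2 (conj I (eq_ind_r (fun t => (t < 1)%R) (proj2 Hr)
     (Rabs_pos_eq r (proj1 Hr))))) (eps / (Rabs K + 1))) as [N HN].
  - apply Rdiv_lt_0_compat; [exact He|]. pose proof (Rabs_pos K). lra.
  - exists N. intros n Hn. specialize (HN n Hn). specialize (H n).
    pose proof (Rabs_pos K) as HK. pose proof (Rle_abs K) as HK'.
    pose proof (pow_le r n (proj1 Hr)) as Hp.
    rewrite Rabs_pos_eq in HN by exact Hp.
    apply (Rmult_lt_compat_l (Rabs K + 1)) in HN; [|lra].
    replace ((Rabs K + 1) * (eps / (Rabs K + 1)))%R with eps in HN by (field; lra).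
    nra.
Qed.

Lemma Ctends_Cmod_le (u : nat -> C) (l : C) (M : R) :
  Ctends u l -> (forall n, (Cmod (u n) <= M)%R) -> (Cmod l <= M)%R.
Proof.
  rewrite Ctends_eps. intros H HM. apply Rnot_lt_le. intros Hl.
  destruct (H (Cmod l - M)%R ltac:(lra)) as [N HN].
  specialize (HN N (le_n N)). specialize (HM N).
  pose proof (Cmod_triangle (u N) (- (u N - l))) as T.
  rewrite Cmod_opp in T. replace (u N + - (u N - l)) with l in T by ring. lra.
Qed.

Lemma Clim_seq_eq (u : nat -> C) (l : C) : Ctends u l -> Clim_seq u = l.
Proof.
  exact (iota_filterlim_locally (V := C_CompleteNormedModule) u l).
Qed.

(** * Finite sums and geometrically dominated series *)

Lemma csum_sum_n (f : nat -> C) (n : nat) :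
  sum_n (G := C_AbelianMonoid) f n = csum f (S n).
Proof.
  induction n as [|n IH].
  - rewrite sum_O. simpl. ring.
  - rewrite sum_Sn, IH. reflexivity.
Qed.

Lemma is_series_csum (f : nat -> C) (l : C) :
  Ctends (csum f) l -> is_series (V := C_NormedModule) f l.
Proof.
  intros H. apply (Ctends_shift _ _ 1) in H.
  refine (Ctends_ext _ _ _ _ H). intros n.
  rewrite Nat.add_1_r. symmetry. apply csum_sum_n.
Qed.

Lemma CSeries_eq (f : nat -> C) (l : C) : Ctends (csum f) l -> CSeries f = l.
Proof.
  intros H. apply is_series_csum in H.
  exact (iota_filterlim_locally (V := C_CompleteNormedModule)
           (sum_n (G := C_AbelianMonoid) f) l H).
Qed.

Lemma csum_ext (f g : nat -> C) (n : nat) :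
  (forall k, (k < n)%nat -> f k = g k) -> csum f n = csum g n.
Proof.
  induction n as [|n IH]; intros H; simpl; [reflexivity|].
  rewrite IH, H; auto.
Qed.

Lemma csum_plus (f g : nat -> C) (n : nat) :
  csum (fun k => f k + g k) n = csum f n + csum g n.
Proof. induction n as [|n IH]; simpl; [|rewrite IH]; ring. Qed.

Lemma csum_minus (f g : nat -> C) (n : nat) :
  csum (fun k => f k - g k) n = csum f n - csum g n.
Proof. induction n as [|n IH]; simpl; [|rewrite IH]; ring. Qed.

Lemma csum_scal (c : C) (f : nat -> C) (n : nat) :
  csum (fun k => c * f k) n = c * csum f n.
Proof. induction n as [|n IH]; simpl; [|rewrite IH]; ring. Qed.

Lemma csum_add (f : nat -> C) (m n : nat) :
  csum f (m + n) = csum f m + csum (fun k => f (m + k)%nat) n.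
Proof.
  induction n as [|n IH].
  - rewrite Nat.add_0_r. simpl. ring.
  - rewrite Nat.add_succ_r. simpl. rewrite IH. ring.
Qed.

(** Both sides run over the triangle r + m < N. Passing to N + 1 adds the antidiagonal r + m = N: on
    the right, each row r < N grows by one entry and the row r = N starts with a single one. *)
Lemma csum_triangle_swap (f : nat -> nat -> C) (N : nat) :
  csum (fun n => csum (fun r => f r (n - r)%nat) (S n)) N
  = csum (fun r => csum (f r) (N - r)) N.
Proof.
  induction N as [|N IH]; [reflexivity|].
  change (csum (fun n => csum (fun r => f r (n - r)%nat) (S n)) N
            + csum (fun r => f r (N - r)%nat) (S N)
          = csum (fun r => csum (f r) (S N - r)) N + csum (f N) (S N - N)).
  rewrite IH.
  rewrite (csum_ext (fun r => csum (f r) (S N - r))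
             (fun r => csum (f r) (N - r) + f r (N - r)%nat)).
  - rewrite csum_plus. replace (S N - N)%nat with 1%nat by lia.
    simpl. rewrite Nat.sub_diag. ring.
  - intros k Hk. rewrite Nat.sub_succ_l by lia. reflexivity.
Qed.

Lemma csum_geom_le (f : nat -> C) (K r : R) (n : nat) :
  (0 <= r < 1)%R -> (0 <= K)%R -> (forall k, (Cmod (f k) <= K * r ^ k)%R) ->
  (Cmod (csum f n) <= K / (1 - r))%R.
Proof.
  intros Hr HK H.
  (* The induction needs the exact partial geometric sum, which is only afterwards bounded by the
     full one. *)
  assert (B : (Cmod (csum f n) <= K * ((1 - r ^ n) / (1 - r)))%R).
  { induction n as [|n IH]; simpl.
    - rewrite Cmod_0. unfold Rdiv. rewrite Rminus_diag, Rmult_0_l. lra.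
    - eapply Rle_trans; [apply Cmod_triangle|]. specialize (H n).
      replace ((1 - r * r ^ n) / (1 - r))%R
        with ((1 - r ^ n) / (1 - r) + r ^ n)%R by (field; lra).
      lra. }
  eapply Rle_trans; [exact B|].
  pose proof (pow_le r n (proj1 Hr)).
  unfold Rdiv. apply Rmult_le_compat_l; [exact HK|].
  rewrite <- (Rmult_1_l (/ (1 - r))) at 2.
  apply Rmult_le_compat_r; [|lra].
  left. apply Rinv_0_lt_compat. lra.
Qed.

Lemma csum_geom_tail (f : nat -> C) (K r : R) (m n : nat) :
  (0 <= r < 1)%R -> (0 <= K)%R -> (forall k, (Cmod (f k) <= K * r ^ k)%R) ->
  (Cmod (csum f (m + n) - csum f m) <= K / (1 - r) * r ^ m)%R.
Proof.
  intros Hr HK H. rewrite csum_add.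
  replace (csum f m + csum (fun k => f (m + k)%nat) n - csum f m)
    with (csum (fun k => f (m + k)%nat) n) by ring.
  eapply Rle_trans.
  - apply (csum_geom_le _ (K * r ^ m) r); [exact Hr| |].
    + apply Rmult_le_pos; [exact HK|apply pow_le; lra].
    + intros k. rewrite Rmult_assoc, <- pow_add. apply H.
  - right. field. lra.
Qed.

(** Comparison with a geometric series gives the limit, and [csum_geom_tail] passes to the limit in
    its first sum. The explicit rate is kept because later estimates must be uniform in a
    parameter. *)
Lemma csum_geom_cv (f : nat -> C) (K r : R) :
  (0 <= r < 1)%R -> (0 <= K)%R -> (forall k, (Cmod (f k) <= K * r ^ k)%R) ->
  exists l, Ctends (csum f) l /\
    forall n, (Cmod (l - csum f n) <= K / (1 - r) * r ^ n)%R.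
Proof.
  intros Hr HK H.
  assert (E : ex_series (V := C_NormedModule) f).
  { apply (ex_series_le (V := C_CompleteNormedModule) f (fun k => K * r ^ k)%R).
    - exact H.
    - apply (ex_series_scal_l (V := R_NormedModule) K (fun k => r ^ k)%R).
      apply ex_series_geom. rewrite Rabs_pos_eq; lra. }
  destruct E as [l Hl]. exists l.
  assert (L : Ctends (csum f) l).
  { rewrite Ctends_eps. intros eps He.
    assert (L : Ctends (fun n => csum f (S n)) l).
    { refine (Ctends_ext _ _ _ _ Hl). intros n. apply csum_sum_n. }
    destruct (proj1 (Ctends_eps _ _) L eps He) as [N HN]. exists (S N).
    intros [|n] Hn; [lia|]. apply HN. lia. }
  split; [exact L|]. intros n.
  apply (Ctends_Cmod_le (fun k => csum f (k + n) - csum f n)).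
  - apply Ctends_plus; [|apply Ctends_const].
    apply Ctends_shift. exact L.
  - intros k. rewrite Nat.add_comm. apply csum_geom_tail; assumption.
Qed.

(** * q-shifted factorials *)

Lemma qpoch_add (y q : C) (m n : nat) :
  qpoch y q (m + n) = qpoch y q m * qpoch (y * q ^ m) q n.
Proof.
  induction n as [|n IH].
  - rewrite Nat.add_0_r. simpl. ring.
  - rewrite Nat.add_succ_r. simpl. rewrite IH, Cpow_add_r. ring.
Qed.

Lemma qpoch_neq0 (y q : C) (n : nat) :
  (forall k, 1 - y * q ^ k <> 0) -> qpoch y q n <> 0.
Proof.
  intros H. induction n as [|n IH]; simpl.
  - exact C1_nz.
  - apply Cmult_neq_0; auto.
Qed.

Lemma one_minus_qpow_neq0 (y q : C) (k : nat) :
  (Cmod q < 1)%R -> (Cmod y < 1)%R -> 1 - y * q ^ k <> 0.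
Proof.
  intros Hq Hy E.
  assert (E1 : y * q ^ k = 1).
  { replace (y * q ^ k) with (1 - (1 - y * q ^ k)) by ring. rewrite E. ring. }
  apply (f_equal Cmod) in E1. rewrite Cmod_mult, Cmod_pow, Cmod_1 in E1.
  pose proof (Cmod_ge_0 q). pose proof (Cmod_ge_0 y).
  pose proof (pow_le (Cmod q) k ltac:(lra)).
  pose proof (pow_incr (Cmod q) 1 k ltac:(lra)) as P. rewrite pow1 in P.
  nra.
Qed.

Lemma Cmod_one_minus_le (y q : C) (k : nat) :
  (Cmod (1 - y * q ^ k) <= 1 + Cmod y * Cmod q ^ k)%R.
Proof.
  eapply Rle_trans; [apply Cmod_triangle|].
  rewrite Cmod_opp, Cmod_1, Cmod_mult, Cmod_pow. lra.
Qed.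

Lemma Cmod_one_minus_ge (y q : C) (k : nat) :
  (1 - Cmod y * Cmod q ^ k <= Cmod (1 - y * q ^ k))%R.
Proof.
  pose proof (Cmod_triangle (1 - y * q ^ k) (y * q ^ k)) as T.
  replace (1 - y * q ^ k + y * q ^ k) with (RtoC 1) in T by ring.
  rewrite Cmod_1, Cmod_mult, Cmod_pow in T. lra.
Qed.

(** From 1 + t <= exp t, the product is at most the exponential of the geometric sum of the |y|
    |q|^k. *)
Lemma qpoch_bounded (y q : C) :
  (Cmod q < 1)%R -> exists M, (0 < M)%R /\ forall n, (Cmod (qpoch y q n) <= M)%R.
Proof.
  intros Hq. pose proof (Cmod_ge_0 q) as Hq0. pose proof (Cmod_ge_0 y) as Hy0.
  exists (exp (Cmod y / (1 - Cmod q))). split; [apply exp_pos|].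
  intros n.
  assert (B : (Cmod (qpoch y q n)
               <= exp (Cmod y * ((1 - Cmod q ^ n) / (1 - Cmod q))))%R).
  { induction n as [|n IH]; simpl.
    - rewrite Cmod_1. unfold Rdiv.
      rewrite Rminus_diag, Rmult_0_l, Rmult_0_r, exp_0. lra.
    - rewrite Cmod_mult.
      replace (Cmod y * ((1 - Cmod q * Cmod q ^ n) / (1 - Cmod q)))%R
        with (Cmod y * ((1 - Cmod q ^ n) / (1 - Cmod q)) + Cmod y * Cmod q ^ n)%R
        by (field; lra).
      rewrite exp_plus. apply Rmult_le_compat; try apply Cmod_ge_0; [exact IH|].
      eapply Rle_trans; [apply Cmod_one_minus_le|]. apply exp_ineq1_le. }
  eapply Rle_trans; [exact B|].
  assert (L : (Cmod y * ((1 - Cmod q ^ n) / (1 - Cmod q))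
               <= Cmod y / (1 - Cmod q))%R).
  { unfold Rdiv. apply Rmult_le_compat_l; [exact Hy0|].
    rewrite <- (Rmult_1_l (/ (1 - Cmod q))) at 2.
    pose proof (pow_le _ n Hq0).
    apply Rmult_le_compat_r; [|lra]. left. apply Rinv_0_lt_compat. lra. }
  destruct L as [L|L]; [left; apply exp_increasing; exact L|rewrite L; lra].
Qed.

(* Weierstrass: a product of factors [1 - s_k] is at least [1 - sum s_k]. *)
Lemma qpoch_ge_half (y q : C) (n : nat) :
  (Cmod q < 1)%R -> (Cmod y / (1 - Cmod q) <= / 2)%R ->
  (/ 2 <= Cmod (qpoch y q n))%R.
Proof.
  intros Hq Hy. pose proof (Cmod_ge_0 q) as Hq0. pose proof (Cmod_ge_0 y) as Hy0.
  set (s := (Cmod y / (1 - Cmod q))%R) in Hy.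
  assert (Es : Cmod y = (s * (1 - Cmod q))%R) by (unfold s; field; lra).
  assert (Hs : (0 <= s)%R) by (apply Rdiv_le_0_compat; lra).
  (* Here [s * (1 - Cmod q ^ n)] is the sum of |y| |q|^k over k < n; [s <= / 2] keeps all the lower
     bounds nonnegative, so that they may be multiplied. *)
  assert (B : (1 - s * (1 - Cmod q ^ n) <= Cmod (qpoch y q n))%R).
  { induction n as [|n IH]; simpl.
    - rewrite Cmod_1. lra.
    - rewrite Cmod_mult. pose proof (Cmod_one_minus_ge y q n) as G.
      pose proof (pow_le _ n Hq0) as P.
      pose proof (pow_incr (Cmod q) 1 n ltac:(lra)) as P1. rewrite pow1 in P1.
      rewrite Es in G.
      set (t := (Cmod q ^ n)%R) in *. set (c := Cmod q) in *.
      assert (0 <= s * (1 - t) <= / 2)%R by nra.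
      assert (0 <= s * (1 - c) * t <= / 2)%R.
      { split; [apply Rmult_le_pos; [nra|lra]|].
        apply Rle_trans with (s * (1 - c))%R; nra. }
      apply Rle_trans
        with ((1 - s * (1 - t)) * (1 - s * (1 - c) * t))%R.
      + nra.
      + apply Rmult_le_compat; lra. }
  pose proof (pow_le _ n Hq0). nra.
Qed.

(** Beyond some K the tail product starts at y q^K, small enough for [qpoch_ge_half]; the finitely
    many products up to K are nonzero and have a positive minimum. *)
Lemma qpoch_bounded_below (y q : C) :
  (Cmod q < 1)%R -> (forall k, 1 - y * q ^ k <> 0) ->
  exists m, (0 < m)%R /\ forall n, (m <= Cmod (qpoch y q n))%R.
Proof.
  intros Hq H. pose proof (Cmod_ge_0 q) as Hq0. pose proof (Cmod_ge_0 y) as Hy0.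
  assert (F : forall K, exists m, (0 < m)%R /\
            forall n, (n <= K)%nat -> (m <= Cmod (qpoch y q n))%R).
  { induction K as [|K [m [Hm IH]]].
    - exists 1%R. split; [lra|]. intros n Hn.
      replace n with 0%nat by lia. simpl. rewrite Cmod_1. lra.
    - exists (Rmin m (Cmod (qpoch y q (S K)))). split.
      + apply Rmin_pos; [exact Hm|]. apply Cmod_gt_0, qpoch_neq0, H.
      + intros n Hn. destruct (Nat.eq_dec n (S K)) as [->|Hne].
        * apply Rmin_r.
        * eapply Rle_trans; [apply Rmin_l|]. apply IH. lia. }
  (* This threshold yields |y q^K| / (1 - |q|) <= 1/2; the summand 1 in the denominator covers y =
     0. *)
  destruct (pow_lt_1_zero (Cmod q) ltac:(rewrite Rabs_pos_eq; lra)
              ((1 - Cmod q) / (2 * (Cmod y + 1)))) as [K HK].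
  { apply Rdiv_lt_0_compat; lra. }
  specialize (HK K (le_n K)).
  rewrite Rabs_pos_eq in HK by (apply pow_le; lra).
  destruct (F K) as [m [Hm HF]]. exists (m / 2)%R. split; [lra|].
  intros n. destruct (le_lt_dec n K) as [Hn|Hn].
  - specialize (HF n Hn). lra.
  - replace n with (K + (n - K))%nat by lia. rewrite qpoch_add, Cmod_mult.
    unfold Rdiv. apply Rmult_le_compat; [lra|lra|apply HF; lia|].
    apply qpoch_ge_half; [exact Hq|].
    rewrite Cmod_mult, Cmod_pow.
    apply (Rmult_lt_compat_l (Cmod y + 1)) in HK; [|lra].
    replace ((Cmod y + 1) * ((1 - Cmod q) / (2 * (Cmod y + 1))))%R
      with ((1 - Cmod q) / 2)%R in HK by (field; lra).
    pose proof (pow_le _ K Hq0).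
    apply Rle_div_l; [lra|]. nra.
Qed.

(** A single factor is the ratio of two consecutive products, the upper one bounded below and the
    lower one bounded above. *)
Lemma one_minus_bounded_below (y q : C) :
  (Cmod q < 1)%R -> (forall k, 1 - y * q ^ k <> 0) ->
  exists m, (0 < m)%R /\ forall k, (m <= Cmod (1 - y * q ^ k))%R.
Proof.
  intros Hq H.
  destruct (qpoch_bounded y q Hq) as [M [HM HB]].
  destruct (qpoch_bounded_below y q Hq H) as [m [Hm Hb]].
  exists (m / M)%R. split; [apply Rdiv_lt_0_compat; lra|].
  intros k. apply Rle_div_l; [exact HM|].
  specialize (Hb (S k)). simpl in Hb. rewrite Cmod_mult in Hb.
  specialize (HB k). pose proof (Cmod_ge_0 (1 - y * q ^ k)). nra.
Qed.

(** The product is 1 plus the sum of its increments -y q^k (y;q)_k, which decay geometrically. *)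
Lemma qpoch_cv (y q : C) :
  (Cmod q < 1)%R -> Ctends (qpoch y q) (qpoch_inf y q).
Proof.
  intros Hq. destruct (qpoch_bounded y q Hq) as [M [HM HB]].
  pose proof (Cmod_ge_0 q) as Hq0. pose proof (Cmod_ge_0 y) as Hy0.
  destruct (csum_geom_cv (fun k => qpoch y q k * (- y * q ^ k)) (M * Cmod y)
              (Cmod q)) as [l [Hl _]].
  - lra.
  - nra.
  - intros k. rewrite !Cmod_mult, Cmod_opp, Cmod_pow, Rmult_assoc.
    apply Rmult_le_compat_r; [|apply HB].
    apply Rmult_le_pos; [lra|apply pow_le; lra].
  - assert (L : Ctends (qpoch y q) (1 + l)).
    { refine (Ctends_ext _ _ _ _ (Ctends_plus _ _ _ _ (Ctends_const 1) Hl)).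
      intros n. induction n as [|n IH]; simpl; [ring|].
      rewrite <- IH. ring. }
    unfold qpoch_inf. rewrite (Clim_seq_eq _ _ L). exact L.
Qed.

Lemma qpoch_inf_neq0 (y q : C) :
  (Cmod q < 1)%R -> (forall k, 1 - y * q ^ k <> 0) -> qpoch_inf y q <> 0.
Proof.
  intros Hq H E. pose proof (qpoch_cv y q Hq) as L. rewrite E in L.
  destruct (qpoch_bounded_below y q Hq H) as [m [Hm Hb]].
  destruct (proj1 (Ctends_eps _ _) L m Hm) as [N HN].
  specialize (HN N (le_n N)). specialize (Hb N).
  replace (qpoch y q N - 0) with (qpoch y q N) in HN by ring. lra.
Qed.

Lemma qpoch_inf_split (y q : C) (n : nat) :
  (Cmod q < 1)%R -> qpoch_inf y q = qpoch y q n * qpoch_inf (y * q ^ n) q.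
Proof.
  intros Hq. apply (Ctends_unique (fun k => qpoch y q (k + n))).
  - apply Ctends_shift, qpoch_cv, Hq.
  - refine (Ctends_ext _ _ _ _ (Ctends_mult _ _ _ _ (Ctends_const _)
              (qpoch_cv (y * q ^ n) q Hq))).
    intros k. rewrite Nat.add_comm. symmetry. apply qpoch_add.
Qed.

(** * The q-Gauss sum *)

(* The lower parameter is [C = A B z], i.e. [z = C / (A B)] in the usual
   statement of q-Gauss, whose [C / A] and [C / B] are then [B z] and [A z]. *)
Definition qgauss_term (A B z q : C) (n : nat) : C :=
  qpoch A q n * qpoch B q n / (qpoch q q n * qpoch (A * B * z) q n) * z ^ n.

(** Both sides are (y;q)_(n+1), with the first or the last factor split off. *)
Lemma qpoch_shift1 (y q : C) (n : nat) :
  (1 - y) * qpoch (y * q) q n = qpoch y q n * (1 - y * q ^ n).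
Proof.
  pose proof (qpoch_add y q 1 n) as H. simpl in H.
  rewrite !Cmult_1_r, Cmult_1_l in H. exact (eq_sym H).
Qed.

Lemma Cdiv_bounded (u v : C) (M m : R) :
  (0 < m)%R -> (Cmod u <= M)%R -> (m <= Cmod v)%R -> (Cmod (u / v) <= M / m)%R.
Proof.
  intros Hm Hu Hv.
  assert (v <> 0) by (apply Cmod_gt_0; lra).
  rewrite Cmod_div by assumption. unfold Rdiv.
  apply Rmult_le_compat; [apply Cmod_ge_0| |exact Hu|].
  - left. apply Rinv_0_lt_compat. lra.
  - apply Rinv_le_contravar; lra.
Qed.

Lemma Cmult_bounded (u v : C) (M N : R) :
  (Cmod u <= M)%R -> (Cmod v <= N)%R -> (Cmod (u * v) <= M * N)%R.
Proof.
  intros Hu Hv. rewrite Cmod_mult.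
  apply Rmult_le_compat; auto using Cmod_ge_0.
Qed.

Lemma Cmult_bounded_below (u v : C) (m n : R) :
  (0 < m)%R -> (0 < n)%R -> (m <= Cmod u)%R -> (n <= Cmod v)%R ->
  (m * n <= Cmod (u * v))%R.
Proof.
  intros Hm Hn Hu Hv. rewrite Cmod_mult. apply Rmult_le_compat; lra.
Qed.

Section QGauss.

Variables (A B z q : C).
Hypothesis Hq : (Cmod q < 1)%R.
Hypothesis Hz : (Cmod z < 1)%R.
Hypothesis HC : forall k, 1 - A * B * z * q ^ k <> 0.

Lemma qgauss_lower_neq0 (N k : nat) : 1 - A * B * (z * q ^ N) * q ^ k <> 0.
Proof.
  replace (A * B * (z * q ^ N) * q ^ k) with (A * B * z * q ^ (N + k)).
  - apply HC.
  - rewrite Cpow_add_r. ring.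
Qed.

(** The constant must not depend on [N]. With C = A B z, the shifted lower factor is (C q^N;q)_n =
    (C;q)_(N+n) / (C;q)_N, hence at least [mC / MC] in modulus for all [N] and [n]. *)
Lemma qgauss_bounded :
  exists K, (0 < K)%R /\ forall N n,
    (Cmod (qgauss_term A B (z * q ^ N) q n) <= K * (Cmod z * Cmod q ^ N) ^ n)%R.
Proof.
  destruct (qpoch_bounded A q Hq) as [MA [HMA BA]].
  destruct (qpoch_bounded B q Hq) as [MB [HMB BB]].
  destruct (qpoch_bounded_below q q Hq
              (fun k => one_minus_qpow_neq0 q q k Hq Hq)) as [mq [Hmq Bq]].
  destruct (qpoch_bounded (A * B * z) q Hq) as [MC [HMC BC]].
  destruct (qpoch_bounded_below (A * B * z) q Hq HC) as [mC [HmC bC]].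
  assert (Hr : (0 < mC / MC)%R) by (apply Rdiv_lt_0_compat; lra).
  exists (MA * MB / (mq * (mC / MC)))%R. split.
  { apply Rdiv_lt_0_compat; apply Rmult_lt_0_compat; lra. }
  intros N n. unfold qgauss_term.
  rewrite <- Cmod_pow, <- Cmod_mult, <- Cmod_pow.
  apply Cmult_bounded; [|lra].
  apply Cdiv_bounded.
  - apply Rmult_lt_0_compat; lra.
  - apply Cmult_bounded; auto.
  - apply Cmult_bounded_below; auto.
    apply Rle_div_l; [lra|].
    apply Rle_trans with (1 := bC (N + n)%nat).
    rewrite qpoch_add, Cmod_mult, Rmult_comm.
    replace (A * B * (z * q ^ N)) with (A * B * z * q ^ N) by ring.
    apply Rmult_le_compat_l; [apply Cmod_ge_0|apply BC].
Qed.

(** The telescoping certificate: the right side is zero at n = 0 and its increments are the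
    differences of the two weighted summands. It tends to 0 with the term, which leaves the
    contiguous relation for the full series. *)
Lemma qgauss_contiguous (n : nat) :
  (1 - A * B * z) * (1 - z) * csum (qgauss_term A B z q) n
  - (1 - A * z) * (1 - B * z) * csum (qgauss_term A B (z * q) q) n
  = - (1 - A * B * z) * (1 - q ^ n) * qgauss_term A B z q n.
Proof.
  induction n as [|n IH].
  - simpl. ring.
  - simpl csum.
    match goal with |- ?a * (?f + ?g) - ?b * (?h + ?k) = _ =>
      replace (a * (f + g) - b * (h + k)) with ((a * f - b * h) + (a * g - b * k))
        by ring end.
    rewrite IH. clear IH. unfold qgauss_term.
    rewrite Cpow_mult_l. simpl qpoch. simpl Cpow.
    assert (HC0 : 1 - A * B * z <> 0).
    { pose proof (HC 0) as H. simpl in H. rewrite Cmult_1_r in H. exact H. }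
    (* The series at z q has lower parameter A B z q; its products are rewritten over those at A B z
       so that [field] sees common atoms. *)
    replace (qpoch (A * B * (z * q)) q n)
      with (qpoch (A * B * z) q n * (1 - A * B * z * q ^ n) / (1 - A * B * z)).
    2:{ rewrite <- qpoch_shift1. replace (A * B * (z * q)) with (A * B * z * q)
          by ring. field. exact HC0. }
    pose proof (qpoch_neq0 (A * B * z) q n HC) as H1.
    pose proof (qpoch_neq0 q q n (fun k => one_minus_qpow_neq0 q q k Hq Hq)) as H2.
    pose proof (HC n) as H3.
    pose proof (one_minus_qpow_neq0 q q n Hq Hq) as H4.
    field. repeat split; assumption.
Qed.

Lemma qgauss_cv (N : nat) :
  Ctends (csum (qgauss_term A B (z * q ^ N) q))
         (CSeries (qgauss_term A B (z * q ^ N) q)).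
Proof.
  destruct qgauss_bounded as [K [HK HB]].
  pose proof (Cmod_ge_0 q). pose proof (Cmod_ge_0 z).
  pose proof (pow_le (Cmod q) N ltac:(lra)).
  pose proof (pow_incr (Cmod q) 1 N ltac:(lra)) as P. rewrite pow1 in P.
  destruct (csum_geom_cv (qgauss_term A B (z * q ^ N) q) K
              (Cmod z * Cmod q ^ N)) as [l [Hl _]].
  - split; [apply Rmult_le_pos; lra|nra].
  - lra.
  - apply HB.
  - rewrite (CSeries_eq _ _ Hl). exact Hl.
Qed.

(** The ratio of the dominating geometric series is |z| |q|^N, so only the zeroth term, which is 1,
    survives; the tail after it is O(|q|^N). *)
Lemma qgauss_tends_1 :
  Ctends (fun N => CSeries (qgauss_term A B (z * q ^ N) q)) 1.
Proof.
  destruct qgauss_bounded as [K [HK HB]].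
  pose proof (Cmod_ge_0 q). pose proof (Cmod_ge_0 z).
  apply (Ctends_dominated _ _ (K / (1 - Cmod z)) (Cmod q)); [lra|].
  intros N.
  pose proof (pow_le (Cmod q) N ltac:(lra)) as P0.
  pose proof (pow_incr (Cmod q) 1 N ltac:(lra)) as P. rewrite pow1 in P.
  set (r := (Cmod z * Cmod q ^ N)%R).
  assert (Hr : (0 <= r <= Cmod z)%R).
  { unfold r. split; [apply Rmult_le_pos; lra|nra]. }
  destruct (csum_geom_cv (qgauss_term A B (z * q ^ N) q) K r)
    as [l [Hl T]].
  - lra.
  - lra.
  - apply HB.
  - rewrite (CSeries_eq _ _ Hl). specialize (T 1%nat).
    replace (csum (qgauss_term A B (z * q ^ N) q) 1) with (RtoC 1) in T.
    2:{ simpl. unfold qgauss_term. simpl. field. }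
    eapply Rle_trans; [exact T|]. rewrite pow_1.
    assert (Hr' : (r <= Cmod q ^ N)%R) by (unfold r; nra).
    apply Rmult_le_compat; [|lra| |exact Hr'].
    + apply Rdiv_le_0_compat; lra.
    + unfold Rdiv. apply Rmult_le_compat_l; [lra|].
      apply Rinv_le_contravar; lra.
Qed.


End QGauss.

Lemma qgauss_step (A B z q : C) :
  (Cmod q < 1)%R -> (Cmod z < 1)%R -> (forall k, 1 - A * B * z * q ^ k <> 0) ->
  (1 - A * B * z) * (1 - z) * CSeries (qgauss_term A B z q)
  = (1 - A * z) * (1 - B * z) * CSeries (qgauss_term A B (z * q) q).
Proof.
  intros Hq Hz HC.
  pose proof (qgauss_cv A B z q Hq Hz HC 0) as L0.
  pose proof (qgauss_cv A B z q Hq Hz HC 1) as L1.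
  simpl Cpow in L0, L1. rewrite Cmult_1_r in L0. rewrite Cmult_1_r in L1.
  destruct (qgauss_bounded A B z q Hq HC) as [K [HK HB]].
  assert (E : forall u v : C, u - v = 0 -> u = v).
  { intros u v H. replace u with (u - v + v) by ring. rewrite H. ring. }
  apply E.
  (* The right side of [qgauss_contiguous] has two limits: the difference of the two series, and 0
     because the term is O(|z|^n) and |1 - q^n| <= 2. *)
  apply (Ctends_unique (fun n =>
           - (1 - A * B * z) * (1 - q ^ n) * qgauss_term A B z q n)).
  - refine (Ctends_ext _ _ _ (qgauss_contiguous A B z q Hq HC) _).
    replace ((1 - A * B * z) * (1 - z) * CSeries (qgauss_term A B z q)
             - (1 - A * z) * (1 - B * z) * CSeries (qgauss_term A B (z * q) q))
      with ((1 - A * B * z) * (1 - z) * CSeries (qgauss_term A B z q)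
            + - ((1 - A * z) * (1 - B * z)) * CSeries (qgauss_term A B (z * q) q))
      by ring.
    refine (Ctends_ext _ _ _ _
              (Ctends_plus _ _ _ _
                 (Ctends_mult _ _ _ _ (Ctends_const _) L0)
                 (Ctends_mult _ _ _ _ (Ctends_const _) L1))).
    intros n. simpl. ring.
  - apply (Ctends_dominated _ _ (Cmod (- (1 - A * B * z)) * 2 * K) (Cmod z)).
    { pose proof (Cmod_ge_0 z). lra. }
    intros n. unfold Cminus at 1. rewrite Copp_0, Cplus_0_r, Rmult_assoc.
    rewrite (Cmod_mult (_ * _)), (Cmod_mult (- _)).
    pose proof (HB 0%nat n) as H. simpl Cpow in H. simpl pow in H.
    rewrite Cmult_1_r, Rmult_1_r in H.
    apply Rmult_le_compat; [| apply Cmod_ge_0 | | exact H].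
    + apply Rmult_le_pos; apply Cmod_ge_0.
    + apply Rmult_le_compat_l; [apply Cmod_ge_0|].
      pose proof (Cmod_one_minus_le 1 q n) as G. rewrite Cmult_1_l, Cmod_1 in G.
      pose proof (pow_incr (Cmod q) 1 n (conj (Cmod_ge_0 q) (Rlt_le _ _ Hq))) as P.
      rewrite pow1 in P. lra.
Qed.

Lemma qgauss_iter (A B z q : C) (N : nat) :
  (Cmod q < 1)%R -> (Cmod z < 1)%R -> (forall k, 1 - A * B * z * q ^ k <> 0) ->
  qpoch (A * B * z) q N * qpoch z q N * CSeries (qgauss_term A B z q)
  = qpoch (A * z) q N * qpoch (B * z) q N
    * CSeries (qgauss_term A B (z * q ^ N) q).
Proof.
  intros Hq Hz HC. induction N as [|N IH].
  - simpl. rewrite !Cmult_1_r. reflexivity.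
  - simpl qpoch.
    assert (Hz' : (Cmod (z * q ^ N) < 1)%R).
    { rewrite Cmod_mult, Cmod_pow.
      pose proof (Cmod_ge_0 q). pose proof (Cmod_ge_0 z).
      pose proof (pow_incr (Cmod q) 1 N ltac:(lra)) as P. rewrite pow1 in P. nra. }
    pose proof (qgauss_step A B (z * q ^ N) q Hq Hz'
                  (qgauss_lower_neq0 A B z q HC N)) as E.
    replace (z * q ^ S N) with (z * q ^ N * q) by (simpl; ring).
    rewrite !Cmult_assoc in E.
    transitivity ((1 - A * B * z * q ^ N) * (1 - z * q ^ N) *
       (qpoch (A * B * z) q N * qpoch z q N * CSeries (qgauss_term A B z q))).
    { ring. }
    rewrite IH.
    transitivity (qpoch (A * z) q N * qpoch (B * z) q N *
       ((1 - A * B * z * q ^ N) * (1 - z * q ^ N) *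
          CSeries (qgauss_term A B (z * q ^ N) q))).
    { ring. }
    rewrite E. ring.
Qed.

(** Letting N grow in [qgauss_iter], the finite products tend to the infinite ones and the series at
    z q^N tends to 1. *)
Theorem qgauss (A B z q : C) :
  (Cmod q < 1)%R -> (Cmod z < 1)%R -> (forall k, 1 - A * B * z * q ^ k <> 0) ->
  Ctends (csum (qgauss_term A B z q))
    (qpoch_inf (A * z) q * qpoch_inf (B * z) q
     / (qpoch_inf (A * B * z) q * qpoch_inf z q)).
Proof.
  intros Hq Hz HC.
  pose proof (qgauss_cv A B z q Hq Hz HC 0) as L0.
  simpl Cpow in L0. rewrite Cmult_1_r in L0.
  replace (_ / _) with (CSeries (qgauss_term A B z q)); [exact L0|].
  pose proof (qpoch_inf_neq0 _ q Hq HC) as H1.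
  pose proof (qpoch_inf_neq0 z q Hq (fun k => one_minus_qpow_neq0 z q k Hq Hz)) as H2.
  assert (E : qpoch_inf (A * B * z) q * qpoch_inf z q * CSeries (qgauss_term A B z q)
              = qpoch_inf (A * z) q * qpoch_inf (B * z) q * 1).
  { apply (Ctends_unique (fun N =>
      qpoch (A * B * z) q N * qpoch z q N * CSeries (qgauss_term A B z q))).
    - auto using Ctends_mult, qpoch_cv, Ctends_const.
    - refine (Ctends_ext _ _ _ (fun N => eq_sym (qgauss_iter A B z q N Hq Hz HC)) _).
      auto using Ctends_mult, qpoch_cv, qgauss_tends_1. }
  rewrite Cmult_1_r in E. rewrite <- E. field. split; assumption.
Qed.

(** * The Bailey pair *)

(** The numerator grows by the exact multiple [S r * 2], so the integer quotient needs no parity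
    argument. *)
Lemma triangular_succ (r : nat) :
  ((S r ^ 2 + S r) / 2 = (r ^ 2 + r) / 2 + S r)%nat.
Proof.
  replace (S r ^ 2 + S r)%nat with (r ^ 2 + r + S r * 2)%nat by (simpl; lia).
  apply Nat.div_add. lia.
Qed.

Lemma triangular_ge (r : nat) : (r <= (r ^ 2 + r) / 2)%nat.
Proof.
  induction r as [|r IH]; [lia|]. rewrite triangular_succ. lia.
Qed.

(* The exponent is [r (r - 1) / 2] at [r]. *)
Fixpoint qtri (q : C) (r : nat) : C :=
  match r with
  | O => 1
  | S k => qtri q k * q ^ k
  end.

Lemma qpow_triangular (q : C) (r : nat) :
  q ^ ((r ^ 2 + r) / 2) = qtri q r * q ^ r.
Proof.
  induction r as [|r IH].
  - simpl. ring.
  - rewrite triangular_succ, Cpow_add_r, IH. simpl. ring.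
Qed.

Lemma one_minus_qpow_S_neq0 (q : C) (n : nat) :
  (Cmod q < 1)%R -> 1 - q ^ S n <> 0.
Proof. intros Hq. exact (one_minus_qpow_neq0 q q n Hq Hq). Qed.

Lemma qpoch_q_neq0 (q : C) (n : nat) : (Cmod q < 1)%R -> qpoch q q n <> 0.
Proof.
  intros Hq. apply qpoch_neq0. intros k. apply one_minus_qpow_neq0; exact Hq.
Qed.

Lemma qpoch_q_S (q : C) (n : nat) :
  qpoch q q (S n) = qpoch q q n * (1 - q ^ S n).
Proof. reflexivity. Qed.

(** Up to normalisation, the summand of the unit Bailey pair relative to q, whose sum over r <= m
    vanishes for m > 0. It is meant for r <= m, where [m - r] is a true difference. *)
Definition alt_term (q : C) (m r : nat) : C :=
  (- (1)) ^ r * qtri q r * (1 - q ^ (2 * r + 1))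
  / (qpoch q q (m - r) * qpoch q q (m + r + 1)).

(** A Gosper certificate: the closed form is zero at k = 0 and its increments are the terms. It
    stops at k = m, before [m - k] would truncate, and m > 0 makes 1 - q^m nonzero. *)
Lemma alt_partial_sum (q : C) (m k : nat) :
  (Cmod q < 1)%R -> (0 < m)%nat -> (k <= m)%nat ->
  csum (alt_term q m) k
  = - ((- (1)) ^ k * qtri q k * (1 - q ^ k)
       / ((1 - q ^ m) * qpoch q q (m - k) * qpoch q q (m + k))).
Proof.
  intros Hq Hm. destruct m as [|m]; [lia|]. clear Hm.
  induction k as [|k IH]; intros Hk.
  - simpl csum. simpl Cpow at 2. unfold Cdiv.
    replace (RtoC 1 - 1) with (RtoC 0) by ring. ring.
  - simpl csum. rewrite IH by lia. clear IH. unfold alt_term.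
    destruct (Nat.le_exists_sub (S k) (S m) Hk) as [s [Es _]].
    replace (S m - k)%nat with (S s) by lia.
    replace (S m - S k)%nat with s by lia.
    replace (S m + S k)%nat with (S (S m + k)) by lia.
    replace (S m + k + 1)%nat with (S (S m + k)) by lia.
    rewrite !qpoch_q_S.
    pose proof (qpoch_q_neq0 q s Hq) as H1.
    pose proof (qpoch_q_neq0 q (S m + k) Hq) as H2.
    pose proof (one_minus_qpow_S_neq0 q s Hq) as H3.
    pose proof (one_minus_qpow_S_neq0 q (S m + k) Hq) as H4.
    pose proof (one_minus_qpow_S_neq0 q m Hq) as H5.
    (* All powers are expressed through q, q^(s+1) and q^k, which [field] can treat as
       independent. *)
    assert (E1 : q ^ S m = q ^ S s * q ^ k) by (rewrite <- Cpow_add_r; f_equal; lia).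
    assert (E2 : q ^ S (S m + k) = q * q ^ S s * q ^ k * q ^ k).
    { rewrite <- Cpow_S, <- !Cpow_add_r. f_equal. lia. }
    assert (E3 : q ^ (2 * k + 1) = q * q ^ k * q ^ k).
    { rewrite <- Cpow_S, <- !Cpow_add_r. f_equal. lia. }
    rewrite E1, E2 in *. rewrite E3. simpl qtri.
    replace (q ^ S k) with (q * q ^ k) by reflexivity.
    replace ((- (1)) ^ S k) with (- (1) * (- (1)) ^ k) by reflexivity.
    set (Q := q ^ S s) in *. clearbody Q.
    field. repeat split; assumption.
Qed.

(** At k = m the closed form for the first m terms is exactly minus the last term. *)
Lemma alt_sum_0 (q : C) (m : nat) :
  (Cmod q < 1)%R -> (0 < m)%nat -> csum (alt_term q m) (S m) = 0.
Proof.
  intros Hq Hm. simpl. rewrite alt_partial_sum by auto. unfold alt_term.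
  rewrite Nat.sub_diag.
  replace (2 * m + 1)%nat with (S (m + m)) by lia.
  replace (m + m + 1)%nat with (S (m + m)) by lia.
  rewrite qpoch_q_S.
  pose proof (qpoch_q_neq0 q (m + m) Hq).
  pose proof (one_minus_qpow_S_neq0 q (m + m) Hq).
  destruct m as [|m]; [lia|].
  pose proof (one_minus_qpow_S_neq0 q m Hq).
  simpl (qpoch q q 0). field. repeat split; assumption.
Qed.

Section PartialFractions.

Variables (q x : C).
Hypothesis Hq : (Cmod q < 1)%R.
Hypothesis Hx0 : x <> 0.
Hypothesis Hx : forall k, 1 - x * q ^ k <> 0.
Hypothesis Hx' : forall k, 1 - q / x * q ^ k <> 0.

(** The denominator pairs the poles x = q^(-r) and x = q^(r+1), which the symmetry x -> q/x
    exchanges; the numerator is free of x. *)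
Definition bailey_alpha (r : nat) : C :=
  (- (1)) ^ r * q ^ ((r ^ 2 + r) / 2) * (1 - q ^ (2 * r + 1))
  / ((1 - x * q ^ r) * (1 - q / x * q ^ r)).

(* With the summand for [n + 1] multiplied by [(1 - x q^(n+1)) (1 - q^(n+2) / x)],
   its difference to the summand for [n] is [q^(n+1) * alt_term q (n+1) r], in which [x]
   no longer occurs. *)
Lemma bailey_pair (n : nat) :
  csum (fun r => bailey_alpha r
                 * / (qpoch q q (n - r) * qpoch q q (n + r + 1))) (S n)
  = / (qpoch x q (S n) * qpoch (q / x) q (S n)).
Proof.
  induction n as [|n IH].
  - simpl. unfold bailey_alpha. simpl.
    pose proof (Hx 0) as H1. pose proof (Hx' 0) as H2. simpl in H1, H2.
    pose proof (one_minus_qpow_S_neq0 q 0 Hq) as H3. simpl in H3.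
    rewrite ?Cmult_1_r in *.
    assert (H4 : x - q <> 0).
    { intros E. apply H2. replace (1 - q / x) with ((x - q) / x) by (field; auto).
      rewrite E. unfold Cdiv. ring. }
    field. repeat split; assumption.
  - set (d := fun k => (1 - x * q ^ k) * (1 - q / x * q ^ k)).
    assert (Hd : forall k, d k <> 0) by (intros k; apply Cmult_neq_0; auto).
    set (f := fun n r => bailey_alpha r
                 * / (qpoch q q (n - r) * qpoch q q (n + r + 1))).
    change (csum (f n) (S n) = / (qpoch x q (S n) * qpoch (q / x) q (S n))) in IH.
    change (csum (f (S n)) (S (S n))
            = / (qpoch x q (S (S n)) * qpoch (q / x) q (S (S n)))).
    assert (E : d (S n) * csum (f (S n)) (S (S n)) = csum (f n) (S n)).
    { assert (S1 : d (S n) * csum (f (S n)) (S n) - csum (f n) (S n)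
                   = q ^ S n * csum (alt_term q (S n)) (S n)).
      { rewrite <- !csum_scal, <- csum_minus. apply csum_ext. intros r Hr.
        unfold f, alt_term, bailey_alpha. fold (d r).
        rewrite qpow_triangular.
        destruct (Nat.le_exists_sub r n ltac:(lia)) as [s [Es _]].
        replace (S n - r)%nat with (S s) by lia.
        replace (n - r)%nat with s by lia.
        replace (S n + r + 1)%nat with (S (n + r + 1)) by lia.
        rewrite !qpoch_q_S.
        pose proof (qpoch_q_neq0 q s Hq) as H1.
        pose proof (qpoch_q_neq0 q (n + r + 1) Hq) as H2.
        pose proof (one_minus_qpow_S_neq0 q s Hq) as H3.
        pose proof (one_minus_qpow_S_neq0 q (n + r + 1) Hq) as H4.
        assert (E1 : q ^ S n = q * q ^ s * q ^ r).
        { rewrite <- Cpow_S, <- Cpow_add_r. f_equal. lia. }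
        assert (E2 : q ^ S (n + r + 1) = q * q * q ^ s * q ^ r * q ^ r).
        { rewrite <- Cmult_assoc, <- Cmult_assoc, <- Cmult_assoc, <- !Cpow_add_r,
            <- !Cpow_S. f_equal. lia. }
        (* Expanded, the two products share the terms 1 and q^(2n+3), and the rest factors. The
           resulting [d r] cancels the denominator of [bailey_alpha], and x with it. *)
        assert (ED : d (S n) - (1 - q ^ S s) * (1 - q ^ S (n + r + 1))
                     = q ^ S s * d r).
        { unfold d. rewrite E1, E2. simpl Cpow. field. exact Hx0. }
        pose proof (Hd r) as H5.
        replace (d (S n)) with
          (q ^ S s * d r + (1 - q ^ S s) * (1 - q ^ S (n + r + 1)))
          by (rewrite <- ED; ring).
        rewrite E1. replace (q ^ S s) with (q * q ^ s) in * by reflexivity.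
        field. repeat split; assumption. }
      (* The index r = n + 1 has no counterpart in the sum for n; there [d (S n)] itself cancels the
         denominator. *)
      assert (S2 : d (S n) * f (S n) (S n) = q ^ S n * alt_term q (S n) (S n)).
      { unfold f, alt_term, bailey_alpha. fold (d (S n)).
        rewrite qpow_triangular, Nat.sub_diag.
        pose proof (qpoch_q_neq0 q (S n + S n + 1) Hq).
        pose proof (Hd (S n)). simpl (qpoch q q 0).
        field. split; assumption. }
      pose proof (alt_sum_0 q (S n) Hq ltac:(lia)) as Z.
      change (csum (alt_term q (S n)) (S n) + alt_term q (S n) (S n) = 0) in Z.
      change (csum (f (S n)) (S (S n)))
        with (csum (f (S n)) (S n) + f (S n) (S n)).
      rewrite Cmult_plus_distr_l, S2.
      replace (csum (f n) (S n)) with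
        (d (S n) * csum (f (S n)) (S n)
         - (d (S n) * csum (f (S n)) (S n) - csum (f n) (S n))) by ring.
      rewrite S1.
      match goal with |- ?u + ?w * ?t = ?u - ?w * ?p =>
        transitivity (u - w * p + w * (p + t)); [ring|] end.
      rewrite Z. ring. }
    rewrite IH in E.
    change (qpoch x q (S (S n))) with (qpoch x q (S n) * (1 - x * q ^ S n)).
    change (qpoch (q / x) q (S (S n)))
      with (qpoch (q / x) q (S n) * (1 - q / x * q ^ S n)).
    pose proof (qpoch_neq0 _ _ (S n) Hx). pose proof (qpoch_neq0 _ _ (S n) Hx').
    pose proof (Hd (S n)) as H5.
    replace (csum (f (S n)) (S (S n)))
      with (/ d (S n) * (d (S n) * csum (f (S n)) (S (S n)))) by (field; auto).
    rewrite E.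
    transitivity (/ (qpoch x q (S n) * qpoch (q / x) q (S n) * d (S n))).
    + field. repeat split; assumption.
    + f_equal. unfold d. ring.
Qed.

Lemma bailey_alpha_bounded :
  exists K, (0 < K)%R /\
    forall r, (Cmod (bailey_alpha r) <= K * Cmod q ^ r)%R.
Proof.
  destruct (one_minus_bounded_below x q Hq Hx) as [m1 [Hm1 B1]].
  destruct (one_minus_bounded_below (q / x) q Hq Hx') as [m2 [Hm2 B2]].
  exists (2 / (m1 * m2))%R. split.
  { apply Rdiv_lt_0_compat; [lra|]. apply Rmult_lt_0_compat; lra. }
  intros r. pose proof (Cmod_ge_0 q) as H0.
  replace (2 / (m1 * m2) * Cmod q ^ r)%R with (1 * Cmod q ^ r * 2 / (m1 * m2))%R
    by (field; lra).
  unfold bailey_alpha. apply Cdiv_bounded.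
  - apply Rmult_lt_0_compat; lra.
  - apply Cmult_bounded; [apply Cmult_bounded|].
    + rewrite Cmod_pow, Cmod_opp, Cmod_1, pow1. lra.
    + rewrite Cmod_pow.
      (* The Gaussian decay is weakened to |q|^r, which is all that the geometric estimates
         require. *)
      pose proof (triangular_ge r) as T.
      replace ((r ^ 2 + r) / 2)%nat with (r + ((r ^ 2 + r) / 2 - r))%nat by lia.
      rewrite pow_add.
      pose proof (pow_le _ r H0).
      pose proof (pow_incr (Cmod q) 1 ((r ^ 2 + r) / 2 - r) ltac:(lra)) as P.
      rewrite pow1 in P. nra.
    + pose proof (Cmod_one_minus_le 1 q (2 * r + 1)) as G.
      rewrite Cmult_1_l, Cmod_1 in G.
      pose proof (pow_incr (Cmod q) 1 (2 * r + 1) ltac:(lra)) as P.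
      rewrite pow1 in P. lra.
  - apply Cmult_bounded_below; auto.
Qed.

End PartialFractions.

(* Interchange of summation in Bailey's lemma, with
   [g r m = delta_(r+m) / ((q)_m (q)_(2r+m+1))]. *)
Lemma bailey_transform (alpha gamma : nat -> C) (g : nat -> nat -> C)
  (K L s r : R) :
  (0 <= s < 1)%R -> (0 <= r < 1)%R -> (0 <= K)%R -> (0 <= L)%R ->
  (forall i, (Cmod (alpha i) <= K * s ^ i)%R) ->
  (forall i m, (Cmod (g i m) <= L * r ^ (i + m))%R) ->
  (forall i, Ctends (csum (g i)) (gamma i)) ->
  exists l, Ctends (csum (fun i => alpha i * gamma i)) l /\
    Ctends (csum (fun n => csum (fun i => alpha i * g i (n - i)%nat) (S n))) l.
Proof.
  intros Hs Hr HK HL Ha Hg Hgam.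
  set (M := (L / (1 - r))%R).
  assert (HM : (0 <= M)%R) by (apply Rdiv_le_0_compat; lra).
  (* A tail estimate uniform in the row: with k = N - i it becomes [M * r ^ N], independent of i,
     and with k = 0 it bounds [gamma i] itself. *)
  assert (T : forall i k,
    (Cmod (gamma i - csum (g i) k) <= M * r ^ (i + k))%R).
  { intros i k.
    pose proof (pow_le r i (proj1 Hr)) as Hp.
    destruct (csum_geom_cv (g i) (L * r ^ i) r) as [l [Hl Tl]].
    - exact Hr.
    - apply Rmult_le_pos; lra.
    - intros m. rewrite Rmult_assoc, <- pow_add. apply Hg.
    - rewrite (Ctends_unique _ _ _ (Hgam i) Hl).
      eapply Rle_trans; [apply Tl|]. right. rewrite pow_add.
      unfold M. field. lra. }
  clearbody M.
  assert (Hag : forall i, (Cmod (alpha i * gamma i) <= K * M * s ^ i)%R).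
  { intros i. pose proof (T i 0%nat) as Ti. simpl csum in Ti.
    unfold Cminus in Ti. rewrite Copp_0, Cplus_0_r in Ti.
    pose proof (pow_le s i (proj1 Hs)) as Hp.
    pose proof (pow_incr r 1 (i + 0) ltac:(lra)) as P. rewrite pow1 in P.
    replace (K * M * s ^ i)%R with (K * s ^ i * M)%R by ring.
    apply Cmult_bounded; [apply Ha|]. nra. }
  destruct (csum_geom_cv (fun i => alpha i * gamma i) (K * M) s) as [l [Hl _]].
  { exact Hs. } { apply Rmult_le_pos; assumption. } { exact Hag. }
  exists l. split; [exact Hl|].
  (* After the triangle swap, the two partial sums differ by the row tails weighted with [alpha], a
     sum of size O(r^N). *)
  assert (D : Ctends (fun N => csum (fun i => alpha i * gamma i) N
     - csum (fun n => csum (fun i => alpha i * g i (n - i)%nat) (S n)) N) 0).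
  { apply (Ctends_dominated _ _ (K * M / (1 - s)) r Hr). intros N.
    rewrite (csum_triangle_swap (fun i m => alpha i * g i m)), <- csum_minus.
    unfold Cminus at 1. rewrite Copp_0, Cplus_0_r.
    pose proof (pow_le r N (proj1 Hr)) as HN.
    replace (K * M / (1 - s) * r ^ N)%R with (K * M * r ^ N / (1 - s))%R
      by (field; lra).
    (* [csum_geom_le] wants its bound at every index, so the summand is set to 0 outside i < N,
       where [N - i] would truncate. *)
    rewrite (csum_ext _ (fun i => if lt_dec i N then
       alpha i * (gamma i - csum (g i) (N - i)) else 0)).
    - apply csum_geom_le; [exact Hs| |].
      + repeat apply Rmult_le_pos; assumption.
      + intros i. destruct (lt_dec i N) as [Hi|Hi].
        * replace (K * M * r ^ N * s ^ i)%R with (K * s ^ i * (M * r ^ N))%R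
            by ring.
          apply Cmult_bounded; [apply Ha|].
          replace N with (i + (N - i))%nat at 2 by lia. apply T.
        * rewrite Cmod_0. pose proof (pow_le s i (proj1 Hs)).
          repeat apply Rmult_le_pos; assumption.
    - intros i Hi. destruct (lt_dec i N); [|lia]. rewrite csum_scal. ring. }
  pose proof (Ctends_plus _ _ _ _ Hl
                (Ctends_mult _ _ _ _ (Ctends_const (- (1))) D)) as R.
  replace (l + - (1) * 0) with l in R by ring.
  refine (Ctends_ext _ _ _ _ R). intros n. simpl. ring.
Qed.

(** * Summation *)

Section Gamma.

Variables (q a b : C).
Hypothesis Hq : (Cmod q < 1)%R.
Hypothesis Ha0 : a <> 0.
Hypothesis Hb0 : b <> 0.
Hypothesis Hab : (Cmod (a * b) < 1)%R.
Hypothesis Hqa : (Cmod (a * q) < 1)%R.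
Hypothesis Hqb : (Cmod (b * q) < 1)%R.

(** Bailey's delta sequence relative to q with parameters q/a and q/b, for which the usual argument
    q^2 / ((q/a) (q/b)) is ab. *)
Definition bailey_delta (n : nat) : C :=
  qpoch (q / a) q n * qpoch (q / b) q n * (a * b) ^ n.

(** Here [m] stands for n - r; the unsimplified [r + m + r + 1] becomes the [n + r + 1] of
    [bailey_pair] once [r + m] is replaced by n. *)
Definition bailey_kernel (r m : nat) : C :=
  bailey_delta (r + m) * / (qpoch q q m * qpoch q q (r + m + r + 1)).

(** Splitting off the factors free of m leaves a 2phi1 series with upper parameters q^(r+1)/a and
    q^(r+1)/b, lower parameter q^(2r+2) and argument ab. The lower parameter is the product of the
    other three, as q-Gauss demands. *)
Lemma bailey_gamma (r : nat) :
  Ctends (csum (bailey_kernel r))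
    (qpoch (q / a) q r * qpoch (q / b) q r
     / (qpoch (a * q) q r * qpoch (b * q) q r) * (a * b) ^ r
     * (qpoch_inf (a * q) q * qpoch_inf (b * q) q
        / (qpoch_inf q q * qpoch_inf (a * b) q))).
Proof.
  pose proof (fun k => one_minus_qpow_neq0 (a * q) q k Hq Hqa) as Na.
  pose proof (fun k => one_minus_qpow_neq0 (b * q) q k Hq Hqb) as Nb.
  pose proof (fun k => one_minus_qpow_neq0 (a * b) q k Hq Hab) as Nab.
  pose proof (fun k => one_minus_qpow_neq0 q q k Hq Hq) as Nq.
  set (A := q / a * q ^ r). set (B := q / b * q ^ r).
  assert (EC : A * B * (a * b) = q * q ^ (2 * r + 1)).
  { unfold A, B. replace (2 * r + 1)%nat with (S (r + r)) by lia.
    simpl. rewrite Cpow_add_r. field. split; assumption. }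
  assert (HC : forall k, 1 - A * B * (a * b) * q ^ k <> 0).
  { intros k. rewrite EC, <- Cmult_assoc, <- Cpow_add_r. apply Nq. }
  pose proof (qgauss A B (a * b) q Hq Hab HC) as L. rewrite EC in L.
  replace (A * (a * b)) with (b * q * q ^ r) in L
    by (unfold A; field; assumption).
  replace (B * (a * b)) with (a * q * q ^ r) in L
    by (unfold B; field; assumption).
  set (c := qpoch (q / a) q r * qpoch (q / b) q r * (a * b) ^ r
            / qpoch q q (2 * r + 1)).
  apply (Ctends_mult _ _ _ _ (Ctends_const c)) in L.
  pose proof (qpoch_neq0 _ _ r Na) as Pa.
  pose proof (qpoch_neq0 _ _ r Nb) as Pb.
  pose proof (qpoch_neq0 _ _ (2 * r + 1) Nq) as Pq.
  pose proof (qpoch_inf_neq0 _ _ Hq Nq) as Iq.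
  pose proof (qpoch_inf_neq0 _ _ Hq Nab) as Iab.
  (* q-Gauss yields infinite products starting at q^(2r+2), a q^(r+1) and b q^(r+1); splitting the
     claimed ones there makes both limits rational in the same atoms. *)
  rewrite (qpoch_inf_split q q (2 * r + 1) Hq) in Iq |- *.
  rewrite (qpoch_inf_split (a * q) q r Hq), (qpoch_inf_split (b * q) q r Hq).
  assert (Iq' : qpoch_inf (q * q ^ (2 * r + 1)) q <> 0).
  { intros E. apply Iq. rewrite E. ring. }
  match type of L with filterlim _ _ (locally ?l) =>
    match goal with |- filterlim _ _ (locally ?l') =>
      replace l' with l by (unfold c; field; repeat split; assumption)
    end end.
  refine (Ctends_ext _ _ _ _ L). intros n. rewrite <- csum_scal.
  apply csum_ext. intros m _.
  unfold bailey_kernel, bailey_delta, qgauss_term, c.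
  replace (r + m + r + 1)%nat with (2 * r + 1 + m)%nat by lia.
  rewrite EC, (qpoch_add (q / a)), (qpoch_add (q / b)), (qpoch_add q q (2 * r + 1)),
    (Cpow_add_r (a * b)).
  fold A B.
  assert (P1 : qpoch (q * q ^ (2 * r + 1)) q m <> 0).
  { apply qpoch_neq0. intros k. rewrite <- Cmult_assoc, <- Cpow_add_r. apply Nq. }
  pose proof (qpoch_neq0 _ _ m Nq) as P2.
  field. repeat split; assumption.
Qed.

Lemma bailey_kernel_bounded :
  exists K, (0 < K)%R /\
    forall r m, (Cmod (bailey_kernel r m) <= K * Cmod (a * b) ^ (r + m))%R.
Proof.
  destruct (qpoch_bounded (q / a) q Hq) as [MA [HMA BA]].
  destruct (qpoch_bounded (q / b) q Hq) as [MB [HMB BB]].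
  destruct (qpoch_bounded_below q q Hq
              (fun k => one_minus_qpow_neq0 q q k Hq Hq)) as [mq [Hmq Bq]].
  assert (Hmq2 : (0 < mq * mq)%R) by (apply Rmult_lt_0_compat; lra).
  exists (MA * MB / (mq * mq))%R. split.
  { apply Rdiv_lt_0_compat; [apply Rmult_lt_0_compat|]; lra. }
  intros r m. unfold bailey_kernel.
  replace (MA * MB / (mq * mq) * Cmod (a * b) ^ (r + m))%R
    with (MA * MB * Cmod (a * b) ^ (r + m) / (mq * mq))%R by (field; lra).
  apply Cdiv_bounded; [exact Hmq2| |].
  - unfold bailey_delta. apply Cmult_bounded.
    + apply Cmult_bounded; auto.
    + rewrite Cmod_pow. lra.
  - apply Cmult_bounded_below; auto.
Qed.

End Gamma.

(** * Integer powers and assembly of the identity *)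

Lemma Cpowz_opp_nat (q : C) (n : nat) : Cpowz q (- Z.of_nat n) = / q ^ n.
Proof.
  destruct n as [|n]; simpl.
  - field.
  - rewrite SuccNat2Pos.id_succ. reflexivity.
Qed.

Lemma Cpowz_nat (q : C) (n : nat) : Cpowz q (Z.of_nat n) = q ^ n.
Proof.
  destruct n as [|n]; [reflexivity|]. unfold Cpowz, Z.of_nat.
  rewrite SuccNat2Pos.id_succ. reflexivity.
Qed.

Theorem theorem5p4 (q a b x : C)
  (hq0 : q <> 0) (ha0 : a <> 0) (hb0 : b <> 0)
  (hq : (Cmod q < 1)%R)
  (hmax : (Rmax (Cmod (a * b)) (Rmax (Cmod (q * a)) (Cmod (q * b))) < 1)%R)
  (hx0 : x <> 0)
  (hx : forall m : Z, x <> Cpowz q m) :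
  let rhs_term (n : nat) : C :=
    (1 - q ^ (2 * n + 1))
    * (((1 - x) * (1 - q / x)) / ((1 - x * q ^ n) * (1 - q ^ (n + 1) / x)))
    * ((qpoch (q / a) q n * qpoch (q / b) q n)
       / (qpoch (a * q) q n * qpoch (b * q) q n))
    * (- (a * b)) ^ n * q ^ ((n ^ 2 + n) / 2) in
  ex_series (phi32_term (q / a) (q / b) q (x * q) (q ^ 2 / x) q (a * b))
  /\ ex_series rhs_term
  /\ (qpoch_inf q q * qpoch_inf (a * b) q)
     / (qpoch_inf (a * q) q * qpoch_inf (b * q) q)
     * phi32 (q / a) (q / b) q (x * q) (q ^ 2 / x) q (a * b)
     = CSeries rhs_term.
Proof.
  intros rhs_term.
  assert (Hab : (Cmod (a * b) < 1)%R).
  { eapply Rle_lt_trans; [apply Rmax_l|exact hmax]. }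
  assert (Hqa : (Cmod (a * q) < 1)%R).
  { rewrite Cmult_comm. eapply Rle_lt_trans; [|exact hmax].
    eapply Rle_trans; [|apply Rmax_r]. apply Rmax_l. }
  assert (Hqb : (Cmod (b * q) < 1)%R).
  { rewrite Cmult_comm. eapply Rle_lt_trans; [|exact hmax].
    eapply Rle_trans; [|apply Rmax_r]. apply Rmax_r. }
  (* A zero of this factor is x = q^(-k), and one of the next is x = q^(k+1): together all integral
     powers. *)
  assert (Hx : forall k, 1 - x * q ^ k <> 0).
  { intros k E. apply (hx (- Z.of_nat k)%Z). rewrite Cpowz_opp_nat.
    pose proof (Cpow_nz q k hq0) as Hk.
    replace x with ((1 - (1 - x * q ^ k)) / q ^ k) by (field; exact Hk).
    rewrite E. field. exact Hk. }
  assert (Hx' : forall k, 1 - q / x * q ^ k <> 0).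
  { intros k E. apply (hx (Z.of_nat (S k))). rewrite Cpowz_nat.
    replace x with (x * (1 - q / x * q ^ k) + q ^ S k)
      by (simpl; field; exact hx0).
    rewrite E. ring. }
  assert (Nx : 1 - x <> 0).
  { pose proof (Hx 0%nat) as H. simpl in H. rewrite Cmult_1_r in H. exact H. }
  assert (Nx' : 1 - q / x <> 0).
  { pose proof (Hx' 0%nat) as H. simpl in H. rewrite Cmult_1_r in H. exact H. }
  pose proof (fun k => one_minus_qpow_neq0 (a * q) q k hq Hqa) as Na.
  pose proof (fun k => one_minus_qpow_neq0 (b * q) q k hq Hqb) as Nb.
  pose proof (fun k => one_minus_qpow_neq0 (a * b) q k hq Hab) as Nab.
  pose proof (fun k => one_minus_qpow_neq0 q q k hq hq) as Nq.
  pose proof (qpoch_inf_neq0 _ _ hq Na) as Ia.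
  pose proof (qpoch_inf_neq0 _ _ hq Nb) as Ib.
  pose proof (qpoch_inf_neq0 _ _ hq Nab) as Iab.
  pose proof (qpoch_inf_neq0 _ _ hq Nq) as Iq.
  destruct (bailey_alpha_bounded q x hq Hx Hx') as [K [HK BK]].
  destruct (bailey_kernel_bounded q a b hq) as [L [HL BL]].
  pose proof (Cmod_ge_0 q) as Hq0. pose proof (Cmod_ge_0 (a * b)) as Hab0.
  destruct (bailey_transform (bailey_alpha q x) _ (bailey_kernel q a b) K L
              (Cmod q) (Cmod (a * b)) ltac:(lra) ltac:(lra) ltac:(lra) ltac:(lra)
              BK BL (bailey_gamma q a b hq ha0 hb0 Hab Hqa Hqb))
    as [l [Lrhs Lphi]].
  set (w := (1 - x) * (1 - q / x)).
  (* The inverse of the quotient of infinite products common to every [gamma] of [bailey_gamma]. *)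
  set (pref := (qpoch_inf q q * qpoch_inf (a * b) q)
     / (qpoch_inf (a * q) q * qpoch_inf (b * q) q)).
  assert (Tphi : Ctends
    (csum (phi32_term (q / a) (q / b) q (x * q) (q ^ 2 / x) q (a * b))) (w * l)).
  { refine (Ctends_ext _ _ _ _ (Ctends_mult _ _ _ _ (Ctends_const w) Lphi)).
    intros N. rewrite <- csum_scal. apply csum_ext. intros n _.
    (* With [bailey_delta] pulled out, the inner sum is that of [bailey_pair]. *)
    rewrite (csum_ext _ (fun r => bailey_delta q a b n * (bailey_alpha q x r
                 * / (qpoch q q (n - r) * qpoch q q (n + r + 1))))).
    2:{ intros r Hr. unfold bailey_kernel.
        replace (r + (n - r))%nat with n by lia. ring. }
    rewrite csum_scal, (bailey_pair q x hq hx0 Hx Hx').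
    (* The first factors of (x;q)_(n+1) and (q/x;q)_(n+1) multiply to [w], leaving the lower
       parameters xq and q^2/x. The upper parameter q of the 3phi2 cancels (q;q)_n. *)
    pose proof (qpoch_add x q 1 n) as E1. pose proof (qpoch_add (q / x) q 1 n) as E2.
    change (1 + n)%nat with (S n) in E1, E2.
    simpl (qpoch _ _ 1) in E1, E2. rewrite Cpow_1_r, Cmult_1_r, Cmult_1_l in E1, E2.
    replace (q / x * q) with (q ^ 2 / x) in E2 by (simpl; field; exact hx0).
    pose proof (qpoch_neq0 _ _ (S n) Hx) as P1.
    pose proof (qpoch_neq0 _ _ (S n) Hx') as P2.
    pose proof (qpoch_neq0 _ _ n Nq) as P3.
    rewrite E1 in P1 |- *. rewrite E2 in P2 |- *.
    unfold phi32_term, bailey_delta, w.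
    assert (P4 : qpoch (x * q) q n <> 0).
    { intros E. apply P1. rewrite E. ring. }
    assert (P5 : qpoch (q ^ 2 / x) q n <> 0).
    { intros E. apply P2. rewrite E. ring. }
    clear - Nx Nx' P3 P4 P5.
    set (y := 1 - q / x) in *. clearbody y.
    field. repeat split; assumption. }
  assert (Trhs : Ctends (csum rhs_term) (pref * (w * l))).
  { refine (Ctends_ext _ _ _ _
      (Ctends_mult _ _ _ _ (Ctends_const pref)
        (Ctends_mult _ _ _ _ (Ctends_const w) Lrhs))).
    intros N. rewrite <- !csum_scal. apply csum_ext. intros n _.
    unfold rhs_term, bailey_alpha, pref, w.
    pose proof (qpoch_neq0 _ _ n Na) as Pa.
    pose proof (qpoch_neq0 _ _ n Nb) as Pb.
    pose proof (Hx n) as H1. pose proof (Hx' n) as H2.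
    replace (q ^ (n + 1) / x) with (q / x * q ^ n)
      by (rewrite Cpow_add_r; simpl; field; exact hx0).
    replace ((- (a * b)) ^ n) with ((- (1)) ^ n * (a * b) ^ n)
      by (rewrite <- Cpow_mult_l; f_equal; ring).
    set (y := q / x) in *. clearbody y.
    field. repeat split; assumption. }
  split; [|split].
  - exists (w * l). apply is_series_csum, Tphi.
  - exists (pref * (w * l)). apply is_series_csum, Trhs.
  - unfold phi32. rewrite (CSeries_eq _ _ Tphi), (CSeries_eq _ _ Trhs). reflexivity.
Qed.
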